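(* The branching space functor $\mathbb{P}^-:\mathbf{Flow}\longrightarrow\mathbf{Top}$ is a left Quillen functor.
   Context: $\mathbf{Top}$ is the category of compactly generated topological spaces (weak Hausdorff $k$-spaces), with the model structure whose weak equivalences are the weak homotopy equivalences and whose fibrations are the Serre fibrations. A flow $X$ consists of a compactly generated space $\mathbb{P}X$ (the path space; its elements are the non-constant execution paths), a discrete space $X^0$ (the $0$-skeleton; its elements are the states), continuous maps $s,t:\mathbb{P}X\to X^0$ (source and target), and a continuous associative map $*:\{(x,y)\in\mathbb{P}X\times\mathbb{P}X;\ t(x)=s(y)\}\to\mathbb{P}X$ with $s(x*y)=s(x)$ and $t(x*y)=t(y)$. A morphism of flows $f:X\to Y$ consists of a set map $f^0:X^0\to Y^0$ and a continuous map $\mathbb{P}f:\mathbb{P}X\to\mathbb{P}Y$ compatible with $s$, $t$ and $*$. The category of flows is $\mathbf{Flow}$. It carries a unique model structure such that: the weak equivalences are the weak S-homotopy equivalences, i.e. the morphisms $f$ with $f^0$ a bijection and $\mathbb{P}f$ a weak homotopy equivalence; the fibrations are the morphisms $f$ with $\mathbb{P}f$ a Serre fibration. (This model structure may be taken as known.) The branching space $\mathbb{P}^-X$ of a flow $X$ is the compactly generated space equipped with a continuous map $h^-:\mathbb{P}X\to\mathbb{P}^-X$ that is universal among continuous maps $\phi$ from $\mathbb{P}X$ to compactly generated spaces with $\phi(x)=\phi(x*y)$ whenever $t(x)=s(y)$ (it is the quotient of $\mathbb{P}X$ by the smallest equivalence relation with closed graph identifying $x$ with $x*y$). The assignment $X\mapsto\mathbb{P}^-X$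 is a functor. A left Quillen functor is a functor between model categories that has a right adjoint and preserves cofibrations and trivial cofibrations. *)

(* Defs.v *)
From HB Require Import structures.
From mathcomp Require Import all_boot all_order all_algebra generic_quotient.
From mathcomp Require Import all_classical reals topology.
Set Implicit Arguments.
Unset Strict Implicit.
Unset Printing Implicit Defensive.

Import Order.TTheory GRing.Theory Num.Theory numFieldTopology.Exports.
Local Open Scope classical_set_scope.
Local Open Scope ring_scope.
Local Open Scope quotient_scope.

Record category := Category {
  obj :> Type;
  hom : obj -> obj -> Type;
  idm : forall X : obj, hom X X;
  compm : forall X Y Z : obj, hom Y Z -> hom X Y -> hom X Z;
  compm_idl : forall (X Y : obj) (f : hom X Y), compm (idm Y) f = f;
  compm_idr : forall (X Y : obj) (f : hom X Y), compm f (idm X) = f;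
  compmA : forall (X Y Z W : obj) (h : hom Z W) (g : hom Y Z) (f : hom X Y),
    compm h (compm g f) = compm (compm h g) f }.

Arguments hom {c} X Y.
Arguments idm {c} X.
Arguments compm {c X Y Z} g f.

Notation "g \oc f" := (compm g f) (at level 40, left associativity).

Record functor (C D : category) := Functor {
  fobj :> C -> D;
  fmap : forall X Y : C, hom X Y -> hom (fobj X) (fobj Y);
  fmap_id : forall X : C, fmap (idm X) = idm (fobj X);
  fmap_comp : forall (X Y Z : C) (g : hom Y Z) (f : hom X Y),
    fmap (g \oc f) = fmap g \oc fmap f }.

Arguments fmap {C D} F {X Y} f : rename.

Definition adjoint (C D : category) (F : functor C D) (G : functor D C) : Prop :=
  exists phi : forall (X : C) (Y : D), hom (F X) Y -> hom X (G Y),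
    [/\ forall X Y, bijective (phi X Y),
        forall (X X' : C) (Y : D) (u : hom X' X) (f : hom (F X) Y),
          phi X' Y (f \oc fmap F u) = phi X Y f \oc u
      & forall (X : C) (Y Y' : D) (v : hom Y Y') (f : hom (F X) Y),
          phi X Y' (v \oc f) = fmap G v \oc phi X Y f].

Definition mor_class (C : category) := forall X Y : C, hom X Y -> Prop.

Definition has_lifting (C : category) (A B X Y : C)
    (i : hom A B) (p : hom X Y) : Prop :=
  forall (u : hom A X) (v : hom B Y), p \oc u = v \oc i ->
    exists h : hom B X, h \oc i = u /\ p \oc h = v.

Definition is_retract (C : category) (A B X Y : C)
    (f : hom A B) (g : hom X Y) : Prop :=
  exists (i : hom A X) (r : hom X A) (j : hom B Y) (q : hom Y B),
    [/\ r \oc i = idm A, q \oc j = idm B, g \oc i = j \oc f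
      & f \oc r = q \oc g].

Definition retract_closed (C : category) (W : mor_class C) : Prop :=
  forall (A B X Y : C) (f : hom A B) (g : hom X Y),
    is_retract f g -> W X Y g -> W A B f.

Definition two_out_of_three (C : category) (W : mor_class C) : Prop :=
  forall (X Y Z : C) (f : hom X Y) (g : hom Y Z),
    [/\ W X Y f -> W Y Z g -> W X Z (g \oc f),
        W X Y f -> W X Z (g \oc f) -> W Y Z g
      & W Y Z g -> W X Z (g \oc f) -> W X Y f].

(* Bicompleteness is a property of the underlying category and is not part of
   the structure; factorizations are not required to be functorial. *)
Record model_structure (C : category) := ModelStructure {
  weq : mor_class C;
  cof : mor_class C;
  fib : mor_class C;
  weq_2of3 : two_out_of_three weq;
  weq_retract : retract_closed weq;
  cof_retract : retract_closed cof;
  fib_retract : retract_closed fib;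
  cof_lifting : forall (A B X Y : C) (i : hom A B) (p : hom X Y),
    cof i -> fib p -> weq p -> has_lifting i p;
  tcof_lifting : forall (A B X Y : C) (i : hom A B) (p : hom X Y),
    cof i -> weq i -> fib p -> has_lifting i p;
  cof_tfib_factor : forall (X Y : C) (f : hom X Y),
    exists (Z : C) (i : hom X Z) (p : hom Z Y),
      [/\ f = p \oc i, cof i, fib p & weq p];
  tcof_fib_factor : forall (X Y : C) (f : hom X Y),
    exists (Z : C) (i : hom X Z) (p : hom Z Y),
      [/\ f = p \oc i, cof i, weq i & fib p] }.

Arguments weq {C} m {X Y}.
Arguments cof {C} m {X Y}.
Arguments fib {C} m {X Y}.

Definition left_quillen (C D : category) (MC : model_structure C)
    (MD : model_structure D) (F : functor C D) : Prop :=
  [/\ exists G : functor D C, adjoint F G,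
      forall (X Y : C) (f : hom X Y), cof MC f -> cof MD (fmap F f)
    & forall (X Y : C) (f : hom X Y),
        cof MC f -> weq MC f -> cof MD (fmap F f) /\ weq MD (fmap F f)].

Definition weak_hausdorff (T : topologicalType) : Prop :=
  forall (K : topologicalType) (u : continuousType K T),
    compact [set: K] -> hausdorff_space K -> closed (range u).

Definition k_open (T : topologicalType) (A : set T) : Prop :=
  forall (K : topologicalType) (u : continuousType K T),
    compact [set: K] -> hausdorff_space K -> open (u @^-1` A).

Definition k_space (T : topologicalType) : Prop :=
  forall A : set T, k_open A -> open A.

Record cgSpace := CGSpace {
  cg_sort :> topologicalType;
  cg_k_space : k_space cg_sort;
  cg_weak_hausdorff : weak_hausdorff cg_sort }.

(* The k-ification of T has the same points as T, with the k-open sets of T as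
   open sets. Limits of compactly generated spaces are the k-ifications of the
   limits computed in all topological spaces. *)
Definition kification (T : Type) : Type := T.

Section Kification.
Variable T : topologicalType.

Lemma k_openT : k_open [set: T].
Proof. by move=> K u _ _; rewrite preimage_setT; exact: openT. Qed.

Lemma k_openI : setI_closed (@k_open T).
Proof.
move=> A B kA kB K u cK hK; rewrite preimage_setI.
by apply: openI; [exact: kA|exact: kB].
Qed.

Lemma k_open_bigU (I : Type) (f : I -> set T) :
  (forall i, k_open (f i)) -> k_open (\bigcup_i f i).
Proof.
move=> kf K u cK hK; rewrite preimage_bigcup.
by apply: bigcup_open => i _; exact: kf.
Qed.

HB.instance Definition _ := Choice.copy (kification T) T.
HB.instance Definition _ :=
  isOpenTopological.Build (kification T) k_openT k_openI k_open_bigU.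

Lemma kification_openE (A : set (kification T)) :
  open A = k_open (A : set T).
Proof. by []. Qed.

Lemma kification_continuous (Y : topologicalType) (f : T -> Y) :
  continuous f -> continuous (f : kification T -> Y).
Proof.
move=> cf; apply/continuousP => A oA; rewrite kification_openE => K u _ _.
apply: (open_comp (f := u)) => [? _|]; first exact: cts_fun.
by move/continuousP : cf; exact.
Qed.

End Kification.

Lemma compact_set_type (T : topologicalType) (A : set T) :
  compact A -> compact [set: A].
Proof.
move=> cA F FF _; pose G : set_system T := set_val @ F.
have GA : G A.
  by rewrite /G /fmap /=; apply: filterS filterT => a _ /=; exact: set_valP.
have [p [Ap clp]] := cA G _ GA.
exists (exist _ p (mem_set Ap)); split => // U V FU [W [[B oB <-] Bp WV]].
have GU : G (set_val @` U).
  by rewrite /G /fmap /=; apply: filterS FU => a Ua; exists a.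
have nB : nbhs p B by apply: open_nbhs_nbhs; split.
have [q [[a Ua aq] Bq]] := clp _ _ GU nB.
by exists a; split => //; apply: WV; rewrite /= aq.
Qed.

Lemma hausdorff_set_type (T : topologicalType) (A : set T) :
  hausdorff_space T -> hausdorff_space A.
Proof.
move=> hT p q clpq; apply/val_inj/hT => U V nU nV.
have [a [Ua Va]] := clpq _ _ (initial_continuous (f := set_val) nU)
                             (initial_continuous (f := set_val) nV).
by exists (val a).
Qed.

Lemma hausdorff_prod (T U : topologicalType) :
  hausdorff_space T -> hausdorff_space U -> hausdorff_space (T * U)%type.
Proof.
move=> hT hU [p1 p2] [q1 q2] clpq; congr pair.
- apply: hT => A B nA nB.
  by have [[a b] [? ?]] := clpq _ _ (cvg_fst nA) (cvg_fst nB); exists a.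
- apply: hU => A B nA nB.
  by have [[a b] [? ?]] := clpq _ _ (cvg_snd nA) (cvg_snd nB); exists b.
Qed.

Lemma weak_hausdorff_image_closed (Z M : topologicalType)
    (a : continuousType M Z) (N : set M) :
  weak_hausdorff Z -> compact [set: M] -> hausdorff_space M -> closed N ->
  closed (a @` N).
Proof.
move=> wZ cM hM cN.
have ca : continuous (a \o set_val : N -> Z).
  move=> x; apply: continuous_comp; last exact: cts_fun.
  exact: initial_continuous.
have -> : a @` N = range (mkcts ca).
  apply/seteqP; split=> [_ [m Nm <-]|_ [m _ <-]].
    by exists (exist _ m (mem_set Nm)).
  by exists (val m) => //; exact: set_valP.
apply: wZ; last exact: hausdorff_set_type.
by apply: compact_set_type; exact: subclosed_compact cN cM _.
Qed.

Lemma weak_hausdorff_equalizer_closed (Z M : topologicalType)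
    (a b : continuousType M Z) :
  weak_hausdorff Z -> compact [set: M] -> hausdorff_space M ->
  closed [set m | a m = b m].
Proof.
move=> wZ cM hM; rewrite -openC openE => m /= abm.
have clbm : closed [set b m].
  rewrite -image_set1; apply: weak_hausdorff_image_closed => //.
  by apply: compact_closed => //; exact: compact_set1.
have na : nbhs m (a @^-1` (~` [set b m])).
  by apply: open_nbhs_nbhs; split => //; apply: open_comp;
    [move=> ? _; exact: cts_fun|rewrite openC].
have [N nN clN] := compact_regular hM cM filterT na.
have nb : nbhs m (b @^-1` (~` (a @` closure N))).
  apply: open_nbhs_nbhs; split; last first.
    by move=> -[m' cm' e]; exact: (clN _ cm').
  apply: open_comp; first by move=> ? _; exact: cts_fun.
  by rewrite openC; apply: weak_hausdorff_image_closed => //;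
    exact: closed_closure.
apply: filterS (filterI nN nb) => m' [Nm' nb'] /= e.
by apply: nb'; exists m' => //; exact: subset_closure.
Qed.

Section TopCategory.

Definition cts_idm (X : cgSpace) : continuousType X X :=
  [the continuousType X X of idfun].

Definition cts_compm (X Y Z : cgSpace) (g : continuousType Y Z)
    (f : continuousType X Y) : continuousType X Z :=
  [the continuousType X Z of g \o f].

Lemma cts_compm_idl (X Y : cgSpace) (f : continuousType X Y) :
  cts_compm (cts_idm Y) f = f.
Proof. exact/continuousEP. Qed.

Lemma cts_compm_idr (X Y : cgSpace) (f : continuousType X Y) :
  cts_compm f (cts_idm X) = f.
Proof. exact/continuousEP. Qed.

Lemma cts_compmA (X Y Z W : cgSpace) (h : continuousType Z W)
    (g : continuousType Y Z) (f : continuousType X Y) :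
  cts_compm h (cts_compm g f) = cts_compm (cts_compm h g) f.
Proof. exact/continuousEP. Qed.

Definition Top : category :=
  Category cts_compm_idl cts_compm_idr cts_compmA.

End TopCategory.

Section Homotopy.
Variable R : realType.

(* Maps defined on a subset of a space, such as the cube or the disc, are
   represented by total functions that are continuous within this subset;
   the values outside of it are irrelevant. *)
Definition cube (n : nat) : set 'rV[R]_n :=
  [set u | forall i, 0 <= u ord0 i <= 1].
Arguments cube n _ : clear implicits.

Definition cube_boundary (n : nat) : set 'rV[R]_n :=
  cube n `&` [set u | exists i, u ord0 i = 0 \/ u ord0 i = 1].
Arguments cube_boundary n _ : clear implicits.

(* The norm of the library on row vectors is the sup norm, so that its unit
   balls are not the Euclidean ones. *)
Definition disc (n : nat) : set 'rV[R]_n :=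
  [set u | \sum_i u ord0 i ^+ 2 <= 1].
Arguments disc n _ : clear implicits.

Definition unit_interval : set R := [set t | 0 <= t <= 1].

Section Spaces.
Variable X : topologicalType.

Definition path_joined (x y : X) : Prop :=
  exists c : R -> X,
    [/\ {within unit_interval, continuous c}, c 0 = x & c 1 = y].

Definition pi0 : set (set X) := range path_joined.

Definition based_map (n : nat) (x : X) (a : 'rV[R]_n -> X) : Prop :=
  {within cube n, continuous a} /\ forall u, cube_boundary n u -> a u = x.

Definition based_homotopic (n : nat) (x : X) (a b : 'rV[R]_n -> X) : Prop :=
  exists H : 'rV[R]_n * R -> X,
    [/\ {within cube n `*` unit_interval, continuous H},
        forall u, cube n u -> H (u, 0) = a u,
        forall u, cube n u -> H (u, 1) = b u
      & forall u t, cube_boundary n u -> unit_interval t -> H (u, t) = x].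

Definition homotopy_class (n : nat) (x : X) (a : 'rV[R]_n -> X) :
    set ('rV[R]_n -> X) :=
  based_map x `&` based_homotopic x a.

Definition pi_ (n : nat) (x : X) : set (set ('rV[R]_n -> X)) :=
  [set homotopy_class x a | a in based_map x].

End Spaces.

Arguments pi0 X : clear implicits.
Arguments pi_ {X} n x _.

Section Maps.
Variables (X Y : topologicalType) (f : X -> Y).

Definition pi0_map (c : set X) : set Y :=
  \bigcup_(x in c) path_joined (f x).

Definition pi_map (n : nat) (x : X) (c : set ('rV[R]_n -> X)) :
    set ('rV[R]_n -> Y) :=
  \bigcup_(a in c) homotopy_class (f x) (f \o a).

(* For n >= 1 the map induced on the n-th homotopy groups is a morphism of
   groups, hence it is an isomorphism if and only if it is bijective. *)
Definition weak_homotopy_equivalence : Prop :=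
  set_bij (pi0 X) (pi0 Y) pi0_map /\
  forall (n : nat) (x : X),
    set_bij (pi_ n.+1 x) (pi_ n.+1 (f x)) (pi_map (n := n.+1) x).

Definition serre_fibration : Prop :=
  forall (n : nat) (g : 'rV[R]_n -> X) (H : 'rV[R]_n * R -> Y),
    {within disc n, continuous g} ->
    {within disc n `*` unit_interval, continuous H} ->
    (forall u, disc n u -> f (g u) = H (u, 0)) ->
    exists L : 'rV[R]_n * R -> X,
      [/\ {within disc n `*` unit_interval, continuous L},
          forall u, disc n u -> L (u, 0) = g u
        & forall u t, disc n u -> unit_interval t -> f (L (u, t)) = H (u, t)].

End Maps.
End Homotopy.

Section Composable.
Variables (P S : topologicalType) (s t : P -> S).

Definition composable : set (P * P) := [set p | t p.1 = s p.2].

Definition composable_pair (x y : P) (txsy : t x = s y) : composable :=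
  exist _ (x, y) (mem_set txsy).

End Composable.

Record flow := Flow {
  path_space : cgSpace;
  states : discreteTopologicalType;
  source : continuousType path_space states;
  target : continuousType path_space states;
  concat : continuousType (kification (composable source target)) path_space;
  source_concat : forall x y (h : target x = source y),
    source (concat (composable_pair h)) = source x;
  target_concat : forall x y (h : target x = source y),
    target (concat (composable_pair h)) = target y;
  concatA : forall x y z (hxy : target x = source y) (hyz : target y = source z)
    (hl : target (concat (composable_pair hxy)) = source z)
    (hr : target x = source (concat (composable_pair hyz))),
    concat (composable_pair hl) = concat (composable_pair hr) }.

Record flow_hom (X Y : flow) := FlowHom {
  on_states : states X -> states Y;
  on_paths : continuousType (path_space X) (path_space Y);
  on_source : forall x, source Y (on_paths x) = on_states (source X x);
  on_target : forall x, target Y (on_paths x) = on_states (target X x);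
  on_concat : forall x y (h : target X x = source X y)
    (h' : target Y (on_paths x) = source Y (on_paths y)),
    on_paths (concat X (composable_pair h)) = concat Y (composable_pair h') }.

Arguments on_states {X Y} f : rename.
Arguments on_paths {X Y} f : rename.

Lemma flow_hom_eq (X Y : flow) (f g : flow_hom X Y) :
  on_states f =1 on_states g -> on_paths f =1 on_paths g -> f = g.
Proof.
case: f g => [f0 f1 ? ? ?] [g0 g1 ? ? ?] /= /funext e0 /continuousEP e1.
by subst g0 g1; congr FlowHom; exact: Prop_irrelevance.
Qed.

Definition flow_id (X : flow) : flow_hom X X.
Proof.
exists id (cts_idm _) => //= x y h h'.
by rewrite (Prop_irrelevance h h').
Defined.

Definition flow_comp (X Y Z : flow) (g : flow_hom Y Z) (f : flow_hom X Y) :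
  flow_hom X Z.
Proof.
exists (on_states g \o on_states f) (cts_compm (on_paths g) (on_paths f)) => /=.
- by move=> x; rewrite !on_source.
- by move=> x; rewrite !on_target.
- move=> x y h h'.
  have h1 : target Y (on_paths f x) = source Y (on_paths f y).
    by rewrite on_target on_source h.
  by rewrite (on_concat h h1) (on_concat h1 h').
Defined.

Lemma flow_comp_idl (X Y : flow) (f : flow_hom X Y) :
  flow_comp (flow_id Y) f = f.
Proof. exact: flow_hom_eq. Qed.

Lemma flow_comp_idr (X Y : flow) (f : flow_hom X Y) :
  flow_comp f (flow_id X) = f.
Proof. exact: flow_hom_eq. Qed.

Lemma flow_compA (X Y Z W : flow) (h : flow_hom Z W) (g : flow_hom Y Z)
    (f : flow_hom X Y) :
  flow_comp h (flow_comp g f) = flow_comp (flow_comp h g) f.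
Proof. exact: flow_hom_eq. Qed.

Definition FlowCat : category :=
  Category flow_comp_idl flow_comp_idr flow_compA.

Definition weak_S_homotopy_equivalence (R : realType) (X Y : flow)
    (f : flow_hom X Y) : Prop :=
  bijective (on_states f) /\ weak_homotopy_equivalence R (on_paths f).

Definition is_top_model_structure (R : realType) (M : model_structure Top) :
    Prop :=
  forall (X Y : Top) (f : hom X Y),
    (weq M f <-> weak_homotopy_equivalence R f) /\
    (fib M f <-> serre_fibration R f).

Definition is_flow_model_structure (R : realType)
    (M : model_structure FlowCat) : Prop :=
  forall (X Y : FlowCat) (f : hom X Y),
    (weq M f <-> weak_S_homotopy_equivalence R f) /\
    (fib M f <-> serre_fibration R (on_paths f)).

Definition branching_invariant (X : flow) (Z : Type) (phi : path_space X -> Z) :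
    Prop :=
  forall x y (h : target X x = source X y),
    phi x = phi (concat X (composable_pair h)).

Section BranchingSpace.
Variable X : flow.

(* The quotient by this relation has the universal property of the branching
   space among compactly generated spaces: see branching_space_universal. *)
Definition branching_rel (x y : path_space X) : bool :=
  `[< forall (Z : cgSpace) (phi : continuousType (path_space X) Z),
        branching_invariant phi -> phi x = phi y >].

Lemma branching_relP x y :
  reflect (forall (Z : cgSpace) (phi : continuousType (path_space X) Z),
             branching_invariant phi -> phi x = phi y)
          (branching_rel x y).
Proof. exact: asboolP. Qed.

Lemma branching_rel_refl : reflexive branching_rel.
Proof. by move=> x; apply/branching_relP. Qed.

Lemma branching_rel_sym : symmetric branching_rel.
Proof.
by move=> x y; apply/branching_relP/branching_relP => e Z phi iphi;
  rewrite (e Z phi iphi).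
Qed.

Lemma branching_rel_trans : transitive branching_rel.
Proof.
move=> y x z /branching_relP exy /branching_relP eyz.
by apply/branching_relP => Z phi iphi; rewrite exy// eyz.
Qed.

Canonical branching_equiv :=
  EquivRel branching_rel branching_rel_refl branching_rel_sym
    branching_rel_trans.

Definition branching_quotient : topologicalType :=
  quotient_topology {eq_quot branching_equiv}.

Local Notation pr := (\pi_(quotient_topology {eq_quot branching_equiv})).

Lemma branching_quotient_k_space : k_space branching_quotient.
Proof.
move=> A kA; apply: (@cg_k_space (path_space X) (pr @^-1` A)) => K u cK hK.
have cu : continuous (pr \o u : K -> branching_quotient).
  by move=> x; apply: continuous_comp; [exact: cts_fun|exact: pi_continuous].
exact: (kA K (mkcts cu)).
Qed.

Section Factor.
Variables (Z : cgSpace) (phi : continuousType (path_space X) Z).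
Hypothesis iphi : branching_invariant phi.

Definition branching_factor_fun : branching_quotient -> Z := phi \o repr.

Lemma branching_factor_funE x : branching_factor_fun (pr x) = phi x.
Proof.
have : repr (pr x) = x %[mod {eq_quot branching_equiv}] by rewrite reprK.
by move/eqquotP/branching_relP; exact.
Qed.

Lemma branching_factor_continuous : continuous branching_factor_fun.
Proof.
apply/quotient_continuous.
rewrite (_ : _ \o _ = phi); first exact: cts_fun.
by apply/funext => x; exact: branching_factor_funE.
Qed.

End Factor.

Lemma branching_quotient_separated (p q : branching_quotient) :
  (forall (Z : cgSpace) (phi : continuousType (path_space X) Z),
     branching_invariant phi ->
     branching_factor_fun phi p = branching_factor_fun phi q) -> p = q.
Proof.
move=> pq; rewrite -[p]reprK -[q]reprK.
by apply/eqquotP/branching_relP; exact: pq.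
Qed.

Lemma branching_quotient_weak_hausdorff : weak_hausdorff branching_quotient.
Proof.
move=> K u cK hK; rewrite -openC; apply: branching_quotient_k_space.
move=> L v cL hL; rewrite preimage_setC; apply: closed_openC.
pose E : set (K * L) := [set kl | u kl.1 = v kl.2].
have cKL : compact [set: K * L].
  by rewrite -setXTT; exact: compact_setX.
have hKL : hausdorff_space (K * L)%type by exact: hausdorff_prod.
have vuE : v @^-1` range u = snd @` E.
  apply/seteqP; split=> [l [k _ ukl]|_ [[k l] /= ukl <-]].
    by exists (k, l).
  by exists k.
suff : closed (snd @` E) by rewrite -vuE.
apply: compact_closed => //; apply: continuous_compact.
  by apply: continuous_subspaceT => x; exact: cvg_snd.
apply: (subclosed_compact _ cKL) => //.
move=> [k l] clE; apply: branching_quotient_separated => Z phi iphi.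
pose Ephi : set (K * L) :=
  [set kl | branching_factor_fun phi (u kl.1) =
            branching_factor_fun phi (v kl.2)].
suff cEphi : closed Ephi.
  by apply: (cEphi (k, l)); apply: closureS clE => kl; rewrite /E /Ephi /= => e; congr branching_factor_fun.
have cu : continuous (branching_factor_fun phi \o u \o fst : K * L -> Z).
  move=> x; apply: continuous_comp; first exact: cvg_fst.
  apply: continuous_comp; first exact: cts_fun.
  exact: branching_factor_continuous.
have cv : continuous (branching_factor_fun phi \o v \o snd : K * L -> Z).
  move=> x; apply: continuous_comp; first exact: cvg_snd.
  apply: continuous_comp; first exact: cts_fun.
  exact: branching_factor_continuous.
exact: (@weak_hausdorff_equalizer_closed Z _ (mkcts cu) (mkcts cv)
  (@cg_weak_hausdorff Z) cKL hKL).
Qed.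

Definition branching_space : cgSpace :=
  CGSpace branching_quotient_k_space branching_quotient_weak_hausdorff.

Definition branching_map : continuousType (path_space X) branching_space :=
  [the continuousType _ _ of mkcts (@pi_continuous _ {eq_quot branching_equiv})].

Lemma branching_map_invariant : branching_invariant branching_map.
Proof.
by move=> x y h; apply/eqquotP/branching_relP => Z phi; exact.
Qed.

Definition branching_factor (Z : cgSpace)
    (phi : continuousType (path_space X) Z) (iphi : branching_invariant phi) :
    continuousType branching_space Z :=
  [the continuousType _ _ of mkcts (branching_factor_continuous iphi)].

Lemma branching_factorE (Z : cgSpace) (phi : continuousType (path_space X) Z)
    (iphi : branching_invariant phi) x :
  branching_factor iphi (branching_map x) = phi x.
Proof. exact: branching_factor_funE. Qed.

Lemma branching_space_ext (T : Type) (g h : branching_space -> T) :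
  (forall x, g (branching_map x) = h (branching_map x)) -> g =1 h.
Proof. by move=> gh p; rewrite -[p]reprK; exact: gh. Qed.

Theorem branching_space_universal (Z : cgSpace)
    (phi : continuousType (path_space X) Z) :
  branching_invariant phi ->
  exists! g : continuousType branching_space Z,
    forall x, g (branching_map x) = phi x.
Proof.
move=> iphi; exists (branching_factor iphi); split.
  exact: branching_factorE.
move=> g gE; apply/continuousEP/branching_space_ext => x.
by rewrite branching_factorE gE.
Qed.

End BranchingSpace.

Lemma branching_map_hom_invariant (X Y : flow) (f : flow_hom X Y) :
  branching_invariant (cts_compm (branching_map Y) (on_paths f)).
Proof.
move=> x y h /=; have h' : target Y (on_paths f x) = source Y (on_paths f y).
  by rewrite on_target on_source h.
by rewrite (on_concat h h') -branching_map_invariant.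
Qed.

Definition branching_hom (X Y : flow) (f : flow_hom X Y) :
    continuousType (branching_space X) (branching_space Y) :=
  branching_factor (branching_map_hom_invariant f).

Lemma branching_homE (X Y : flow) (f : flow_hom X Y) x :
  branching_hom f (branching_map X x) = branching_map Y (on_paths f x).
Proof. exact: branching_factorE. Qed.

Lemma branching_hom_id (X : FlowCat) :
  branching_hom (idm X) = idm (branching_space X : Top).
Proof.
by apply/continuousEP/branching_space_ext => x; rewrite branching_homE.
Qed.

Lemma branching_hom_comp (X Y Z : FlowCat) (g : hom Y Z) (f : hom X Y) :
  branching_hom (g \oc f) =
  (branching_hom g : @hom Top _ _) \oc (branching_hom f : @hom Top _ _).
Proof.
apply/continuousEP/branching_space_ext => x /=.
by rewrite !branching_homE.
Qed.

Definition branching_functor : functor FlowCat Top :=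
  @Functor FlowCat Top branching_space branching_hom
    branching_hom_id branching_hom_comp.

(* Main.v *)
(** The right adjoint of the branching space functor sends a space [Z] to the
    flow with a single state, path space [Z] and composition [x * y = x]: a
    morphism from [X] to it is a continuous map [phi] on the paths of [X] with
    [phi (x * y) = phi x]. This adjoint is the identity on path spaces and
    bijective on states, so it preserves fibrations and trivial fibrations; by
    adjunction and the retract argument the branching space functor preserves
    cofibrations and trivial cofibrations. *)
From mathcomp Require Import all_boot.
From mathcomp Require Import all_classical reals topology.
Require Import Defs.
Set Implicit Arguments.
Unset Strict Implicit.
Unset Printing Implicit Defensive.

(** The bijections of the adjunction turn a square from [fmap F i] to [p] into one from [i] to
    [fmap G p]; naturality makes it commute, and injectivity brings both triangles of the lift
    back. *)
Lemma adjoint_has_lifting (C D : category) (F : functor C D) (G : functor D C)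
    (A B : C) (X Y : D) (i : hom A B) (p : hom X Y) :
  adjoint F G -> has_lifting i (fmap G p) -> has_lifting (fmap F i) p.
Proof.
move=> [phi [phi_bij phi_natl phi_natr]] lift u v puvi.
have [|h [hi ph]] := lift (phi _ _ u) (phi _ _ v).
  by rewrite -phi_natr -phi_natl puvi.
have [psi _ psiK] := phi_bij B X.
exists (psi h); split; apply: (bij_inj (phi_bij _ _)).
  by rewrite phi_natl psiK.
by rewrite phi_natr psiK.
Qed.

(** Lifting in the square with top [i] and bottom the identity gives a section [h] of [p], which
    exhibits [f] as a retract of [i] under [A]. *)
Lemma retract_argument (C : category) (A B Z : C) (f : hom A B) (i : hom A Z)
    (p : hom Z B) :
  f = p \oc i -> has_lifting f p -> is_retract f i.
Proof.
move=> fE /(_ i (idm B)); rewrite compm_idl => /(_ (esym fE)) [h [hf ph]].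
exists (idm A), (idm A), h, p.
by rewrite !compm_idl !compm_idr; split=> //; exact: esym.
Qed.

Section ModelStructure.
Variables (C : category) (M : model_structure C).

Lemma cof_of_lifting (A B : C) (f : hom A B) :
  (forall (X Y : C) (p : hom X Y), fib M p -> weq M p -> has_lifting f p) ->
  cof M f.
Proof.
(* Lifting against the trivial fibration [p] makes [f] a retract of the cofibration [i]. *)
move=> lift; have [Z [i [p [fE ci fp wp]]]] := cof_tfib_factor M f.
by apply: cof_retract ci; exact: retract_argument fE (lift _ _ _ fp wp).
Qed.

Lemma tcof_of_lifting (A B : C) (f : hom A B) :
  (forall (X Y : C) (p : hom X Y), fib M p -> has_lifting f p) ->
  cof M f /\ weq M f.
Proof.
move=> lift; have [Z [i [p [fE ci wi fp]]]] := tcof_fib_factor M f.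
have fi := retract_argument fE (lift _ _ _ fp).
by split; [exact: cof_retract fi ci|exact: weq_retract fi wi].
Qed.

End ModelStructure.

Lemma left_quillen_of_right (C D : category) (MC : model_structure C)
    (MD : model_structure D) (F : functor C D) (G : functor D C) :
  adjoint F G ->
  (forall (X Y : D) (p : hom X Y), fib MD p -> fib MC (fmap G p)) ->
  (forall (X Y : D) (p : hom X Y),
    fib MD p -> weq MD p -> weq MC (fmap G p)) ->
  left_quillen MC MD F.
Proof.
move=> FG Gfib Gtfib; split=> [|X Y f cf|X Y f cf wf]; first by exists G.
- apply: cof_of_lifting => A B p fp wp; apply: (adjoint_has_lifting FG).
  by apply: (cof_lifting cf); [exact: Gfib|exact: Gtfib].
- apply: tcof_of_lifting => A B p fp; apply: (adjoint_has_lifting FG).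
  by apply: (tcof_lifting cf wf); exact: Gfib.
Qed.

Section LeftProjectionFlow.
Variable Z : cgSpace.

Definition to_point : continuousType Z (discrete_topology unit) :=
  [the continuousType Z (discrete_topology unit) of cst (tt : discrete_topology unit)].

Let first : kification (composable to_point to_point) -> Z :=
  fun p => (\val p).1.

Let first_continuous : continuous first.
Proof.
apply: kification_continuous => p; apply: continuous_comp; last exact: cvg_fst.
exact: initial_continuous.
Qed.

(** Both bracketings of a triple composite reduce to its first factor, so the axioms hold by
    computation. *)
Definition left_projection_flow : flow :=
  @Flow Z (discrete_topology unit) to_point to_point (mkcts first_continuous)
    (fun _ _ _ => erefl) (fun _ _ _ => erefl) (fun _ _ _ _ _ _ _ => erefl).

End LeftProjectionFlow.

Definition left_projection_hom (Y Z : cgSpace) (f : continuousType Y Z) :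
    flow_hom (left_projection_flow Y) (left_projection_flow Z) :=
  @FlowHom (left_projection_flow Y) (left_projection_flow Z) id f
    (fun _ => erefl) (fun _ => erefl) (fun _ _ _ _ => erefl).

Lemma left_projection_hom_id (Z : Top) :
  left_projection_hom (idm Z) = idm (left_projection_flow Z : FlowCat).
Proof. exact: flow_hom_eq. Qed.

Lemma left_projection_hom_comp (X Y Z : Top) (g : hom Y Z) (f : hom X Y) :
  left_projection_hom (g \oc f) =
  (left_projection_hom g : @hom FlowCat _ _) \oc
  (left_projection_hom f : @hom FlowCat _ _).
Proof. exact: flow_hom_eq. Qed.

Definition left_projection_functor : functor Top FlowCat :=
  @Functor Top FlowCat left_projection_flow left_projection_hom
    left_projection_hom_id left_projection_hom_comp.

Section Transpose.
Variables (X : flow) (Z : cgSpace).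

Definition transpose (g : continuousType (branching_space X) Z) :
  flow_hom X (left_projection_flow Z).
Proof.
exists (fun=> tt) (cts_compm g (branching_map X)) => //= x y h h'.
by rewrite -branching_map_invariant.
Defined.

(** Concatenation in the target returns its first factor; [erefl] proves composability there, as
    there is only one state. *)
Lemma on_paths_invariant (f : flow_hom X (left_projection_flow Z)) :
  branching_invariant (on_paths f).
Proof. by move=> x y h; rewrite (@on_concat _ _ f x y h erefl). Qed.

Lemma transpose_bij : bijective transpose.
Proof.
(* The inverse comes from the universal property of the branching space. *)
exists (fun f => branching_factor (on_paths_invariant f)) => [g|f].
  by apply/continuousEP/branching_space_ext => x; rewrite branching_factorE.
apply: flow_hom_eq => [a|x] /=; first by case: (on_states f a).
exact: branching_factorE.
Qed.

End Transpose.

Lemma branching_adjoint : adjoint branching_functor left_projection_functor.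
Proof.
exists transpose; split=> [X Z|X X' Z u g|X Y Z v g].
- exact: transpose_bij.
- by apply: flow_hom_eq => // x; congr (g _); exact: branching_homE.
- exact: flow_hom_eq.
Qed.

Theorem theorem5p5 (R : realType)
    (MFlow : model_structure FlowCat) (MTop : model_structure Top)
    (hFlow : is_flow_model_structure R MFlow)
    (hTop : is_top_model_structure R MTop) :
  left_quillen MFlow MTop branching_functor.
Proof.
apply: (left_quillen_of_right branching_adjoint) => Y Z p.
  by move=> /(proj2 (hTop _ _ _)) fp; apply/(proj2 (hFlow _ _ _)).
move=> _ /(proj1 (hTop _ _ _)) wp; apply/(proj1 (hFlow _ _ _)).
(* The right adjoint leaves [p] unchanged on paths and is the identity, its own inverse, on
   states. *)
by split=> //=; exists id.
Qed.
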